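(* Let $(Q,\cdot,\backslash,/)$ be a universal Osborn loop with identity element $e$. Then for all $x,z,u,v\in Q$, $$\Big(\big(u\cdot[x\backslash(zv)]\big)/[u\backslash(xv)]\Big)\cdot v=\bigg(\Big(\big(u\cdot\big(x\backslash\{z\cdot(u\backslash((u/v)\cdot[u\backslash(xv)]))\}\big)\big)/[u\backslash(xv)]\Big)\cdot v\bigg)\cdot\Big(u\backslash\big([(uv)/(u\backslash(xv))]\cdot v\big)\Big).$$ Furthermore, for all $x,y,z\in Q$, $$z=x\cdot\Big(\big(\big([x\backslash(zx)]/x\big)\cdot x^\lambda\big)\cdot x\Big)$$ and $$\Big(\big(x^\lambda\cdot(x\cdot y)\big)\cdot x^\lambda\Big)\cdot x=y .$$
   Context: A loop $(Q,\cdot,\backslash,/)$ is a quasigroup with two-sided identity $e$; $x\backslash y$ is the unique solution $z$ of $xz=y$, and $y/x$ is the unique solution $z$ of $zx=y$. The left inverse $x^\lambda$ of $x$ is defined by $x^\lambda x=e$. Juxtaposition binds more tightly than $\cdot$. An Osborn loop is a loop satisfying $x(yz\cdot x)=(x^\lambda\backslash y)\cdot zx$ for all $x,y,z$; equivalently $x(yz\cdot x)=x(yx^\lambda\cdot x)\cdot zx$ for all $x,y,z$. A triple $(A,B,C)$ of bijections from $G$ onto $H$ is an isotopism of $(G,\cdot)$ onto $(H,\star)$ if $xA\star yB=(x\cdot y)C$ for all $x,y\in G$ (maps written on the right); $(H,\star)$ is then called an isotope of $(G,\cdot)$. A loop is a universal Osborn loop if all of its loop isotopes are Osborn loops. *)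

(* Defs.v *)
From mathcomp Require Import ssreflect ssrfun ssrbool.

Set Implicit Arguments.
Unset Strict Implicit.
Unset Printing Implicit Defensive.

Declare Scope loop_scope.
Delimit Scope loop_scope with L.

Record loop := Loop {
  carrier :> Type;
  mul : carrier -> carrier -> carrier;
  ldiv : carrier -> carrier -> carrier;
  rdiv : carrier -> carrier -> carrier;
  loop_id : carrier;
  mul_ldivP : forall x y z, mul x z = y <-> z = ldiv x y;
  mul_rdivP : forall x y z, mul z x = y <-> z = rdiv y x;
  mul_loop_idl : forall x, mul loop_id x = x;
  mul_loop_idr : forall x, mul x loop_id = x
}.

Arguments loop_id {l}.

Notation "x * y" := (mul x y) : loop_scope.
Notation "x \ y" := (ldiv x y) (at level 40, left associativity) : loop_scope.
Notation "x / y" := (rdiv x y) : loop_scope.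

Local Open Scope loop_scope.

(* By [mul_rdivP], [loop_id / x] is the unique [z] such that [z * x = loop_id]. *)
Definition linv (Q : loop) (x : Q) : Q := loop_id / x.

Definition osborn (Q : loop) : Prop :=
  forall x y z : Q, x * ((y * z) * x) = (linv x \ y) * (z * x).

Definition isotopism (G H : loop) (A B C : G -> H) : Prop :=
  [/\ bijective A, bijective B, bijective C
    & forall x y : G, A x * B y = C (x * y)].

Definition isotopic (G H : loop) : Prop :=
  exists A B C : G -> H, isotopism A B C.

(* [H] lives in the same universe as [Q]. This loses no generality, since the
   carrier of an isotope of [Q] is in bijection with that of [Q]. *)
Definition universal_osborn (Q : loop) : Prop :=
  forall H : loop, isotopic Q H -> osborn H.

(* Main.v *)
From mathcomp Require Import ssreflect ssrfun ssrbool.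
Require Import Defs.

Local Open Scope loop_scope.

(** Up to isomorphism, the loop isotopes of [Q] are the principal isotopes
    [x o y = (x / v) * (u \ y)], with identity [u * v].  Writing the Osborn
    identity of such an isotope in terms of the operations of [Q], and putting
    [w = u \ (x * v)], gives
      [x * (u \ (((y * z) / v) * w)) = a y * b z]    (see [universal_osborn_eq])
    where [a y] depends on [y] but not on [z], and [b z] on [z] but not on [y].
    Solved for the product, this reads
      [y * z = ((u * (x \ (a y * b z))) / w) * v].
    The first identity eliminates [a]: taking [z = loop_id] expresses [y]
    through the value [c = a y], and taking the [z] for which [b z = v] then
    computes [y * z] in terms of [c] alone.

    With [u = v = loop_id] the first identity becomes
    [(x \ z) / x = ((x \ (z * x)) / x) * linv x], which is the second one.
    With the consequence [x * (y * x) = (linv x \ y) * x] of the Osborn identity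
    it says that right multiplication by [linv x], then by [x], then left
    multiplication by [x], then by [linv x] compose to the identity map.  These
    maps are bijections, so their composite stays the identity when they are
    permuted cyclically; starting from the two left multiplications is the
    third identity. *)

Section Division.
Context {Q : loop}.
Implicit Types x y z : Q.

Lemma mul_ldivK x y : x * (x \ y) = y.
Proof. exact/mul_ldivP. Qed.

Lemma ldiv_mulK x y : x \ (x * y) = y.
Proof. by apply/esym/mul_ldivP. Qed.

Lemma rdiv_mulK x y : (x / y) * y = x.
Proof. exact/mul_rdivP. Qed.

Lemma mul_rdivK x y : (x * y) / y = x.
Proof. by apply/esym/mul_rdivP. Qed.

Lemma mul_left_inj x y z : x * y = x * z -> y = z.
Proof. by move=> E; rewrite -(ldiv_mulK x y) E ldiv_mulK. Qed.

Lemma mul_right_inj x y z : y * x = z * x -> y = z.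
Proof. by move=> E; rewrite -(mul_rdivK y x) E mul_rdivK. Qed.

Lemma ldiv_idl y : loop_id \ y = y.
Proof. by rewrite -{2}(mul_ldivK loop_id y) mul_loop_idl. Qed.

Lemma rdiv_idr y : y / loop_id = y.
Proof. by rewrite -{2}(rdiv_mulK y loop_id) mul_loop_idr. Qed.

End Division.

Section PrincipalIsotope.
Context {Q : loop} (u v : Q).

Definition pmul (x y : Q) : Q := (x / v) * (u \ y).
Definition pldiv (x y : Q) : Q := u * ((x / v) \ y).
Definition prdiv (y x : Q) : Q := (y / (u \ x)) * v.

Lemma pmul_ldivP x y z : pmul x z = y <-> z = pldiv x y.
Proof.
rewrite /pmul /pldiv; split=> [<- | ->]; last by rewrite ldiv_mulK mul_ldivK.
by rewrite ldiv_mulK mul_ldivK.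
Qed.

Lemma pmul_rdivP x y z : pmul z x = y <-> z = prdiv y x.
Proof.
rewrite /pmul /prdiv; split=> [<- | ->]; last by rewrite mul_rdivK rdiv_mulK.
by rewrite mul_rdivK rdiv_mulK.
Qed.

Lemma pmul_idl x : pmul (u * v) x = x.
Proof. by rewrite /pmul mul_rdivK mul_ldivK. Qed.

Lemma pmul_idr x : pmul x (u * v) = x.
Proof. by rewrite /pmul ldiv_mulK rdiv_mulK. Qed.

Definition principal_isotope : loop :=
  Loop pmul_ldivP pmul_rdivP pmul_idl pmul_idr.

Lemma isotopic_principal_isotope : isotopic Q principal_isotope.
Proof.
exists (fun x => x * v), (fun y => u * y), id; split.
- by exists (fun x => x / v) => x; rewrite (mul_rdivK, rdiv_mulK).
- by exists (fun x => u \ x) => x; rewrite (ldiv_mulK, mul_ldivK).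
- by exists id.
- by move=> x y; rewrite /= /pmul mul_rdivK ldiv_mulK.
Qed.

(** The Osborn identity of the principal isotope at [x * v], [y * v], [u * z]:
    this choice turns [pmul (y * v) (u * z)] into [y * z] and the outer left
    factor [(x * v) / v] into [x]. *)
Lemma universal_osborn_eq (x y z : Q) : universal_osborn Q ->
  x * (u \ (((y * z) / v) * (u \ (x * v)))) =
  ((u * (((u * v) / (u \ (x * v))) \ (y * v))) / v)
    * (u \ (((u * z) / v) * (u \ (x * v)))).
Proof.
move=> /(_ _ isotopic_principal_isotope) /(_ (x * v) (y * v) (u * z)).
by rewrite /linv /= /pmul /pldiv /prdiv !mul_rdivK ldiv_mulK.
Qed.

End PrincipalIsotope.

Section UniversalOsborn.
Context {Q : loop} (hQ : universal_osborn Q).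

Lemma universal_osborn_osborn : osborn Q.
Proof. by apply: hQ; exists id, id, id; split=> //; exists id. Qed.

Lemma universal_osborn_elim (x z u v : Q) :
  ((u * (x \ (z * v))) / (u \ (x * v))) * v =
  (((u * (x \ (z * (u \ ((u / v) * (u \ (x * v))))))) / (u \ (x * v))) * v)
    * (u \ (((u * v) / (u \ (x * v))) * v)).
Proof.
set w := u \ (x * v); set y := (X in _ = X * _).
(* [y] was chosen so that its factor in [universal_osborn_eq] is [z]. *)
have zE : (u * (((u * v) / w) \ (y * v))) / v = z.
  apply: (@mul_right_inj _ (u \ ((u / v) * w))).
  have := universal_osborn_eq u v x y loop_id hQ.
  rewrite -/w !mul_loop_idr => <-.
  by rewrite mul_rdivK rdiv_mulK ldiv_mulK mul_ldivK.
(* This third argument makes the other factor equal to [v]. *)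
have := universal_osborn_eq u v x y (u \ (((u * v) / w) * v)) hQ.
rewrite -/w zE mul_ldivK mul_rdivK rdiv_mulK ldiv_mulK => <-.
by rewrite ldiv_mulK mul_ldivK mul_rdivK rdiv_mulK.
Qed.

Lemma ldiv_rdiv_linv (x z : Q) : (x \ z) / x = ((x \ (z * x)) / x) * linv x.
Proof.
have := universal_osborn_elim x z loop_id loop_id.
by rewrite !(mul_loop_idl, mul_loop_idr, ldiv_idl, rdiv_idr).
Qed.

Lemma ldiv_linv_mulE (x y : Q) : linv x \ y = x * ((y * linv x) * x).
Proof.
have osb : x * (y * x) = (linv x \ y) * x.
  have := universal_osborn_osborn x y loop_id.
  by rewrite mul_loop_idr mul_loop_idl.
have := ldiv_rdiv_linv x (linv x \ y).
by rewrite -osb ldiv_mulK mul_rdivK => <-; rewrite rdiv_mulK mul_ldivK.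
Qed.

Lemma linv_mul_mul_linvK (x y : Q) : ((linv x * (x * y)) * linv x) * x = y.
Proof. by apply: (@mul_left_inj _ x); rewrite -ldiv_linv_mulE ldiv_mulK. Qed.

End UniversalOsborn.

Theorem theorem2p2 (Q : loop) (hQ : universal_osborn Q) :
  (forall x z u v : Q,
     ((u * (x \ (z * v))) / (u \ (x * v))) * v =
     (((u * (x \ (z * (u \ ((u / v) * (u \ (x * v))))))) / (u \ (x * v))) * v)
       * (u \ (((u * v) / (u \ (x * v))) * v))) /\
  (forall x y z : Q,
     z = x * ((((x \ (z * x)) / x) * linv x) * x) /\
     ((linv x * (x * y)) * linv x) * x = y).
Proof.
split; first exact: universal_osborn_elim.
move=> x y z; split; last exact: linv_mul_mul_linvK.
by rewrite -ldiv_rdiv_linv // rdiv_mulK mul_ldivK.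
Qed.
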